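(* Let $n$ be a positive integer, let $\alpha$ be an umbra, and let $\alpha_1,\ldots,\alpha_n$ be pairwise uncorrelated umbrae, each similar to $\alpha$. Let $\lambda=(1^{r_1},2^{r_2},\ldots)$ be a partition of an integer $m\le n$ (so $r_i$ is the number of parts of $\lambda$ equal to $i$), and put $k=\sum_i r_i$. Then $$(\alpha_{j_1})^{.r_1}\,(\alpha_{j_2}^2)^{.r_2}\cdots\;\simeq\;\frac{1}{(n)_k}\,[n.(\chi\alpha)]^{r_1}\,[n.(\chi\alpha^2)]^{r_2}\cdots,$$ where $j_1,j_2,\ldots\in\{1,2,\ldots,n\}$ and the factors $(\alpha_{j_1})^{.r_1},(\alpha_{j_2}^2)^{.r_2},\ldots$ are mutually uncorrelated.
   Context: Umbral calculus. $A$ is an alphabet whose elements are called umbrae; $R$ is a commutative integral domain whose quotient field $K$ has characteristic zero; $E:R[A]\to R$ is an $R$-linear functional (evaluation) with $E[1]=1$ and $E[\alpha^i\beta^j\cdots\gamma^k]=E[\alpha^i]E[\beta^j]\cdots E[\gamma^k]$ for distinct umbrae $\alpha,\beta,\ldots,\gamma\in A$ and non-negative integers $i,j,\ldots,k$. $E$ is extended $K$-linearly to $K[A]$, so that rational coefficients such as $1/(n)_k$ make sense. An element of $R[A]$ is an umbral polynomial; its support is the set of umbrae occurring in it; umbral polynomials are uncorrelated when their supports are disjoint. Two umbral polynomials $p,q$ are umbrally equivalent, $p\simeq q$, if $E[p]=E[q]$. Two umbrae $\alpha,\gamma$ are similar, $\alpha\equiv\gamma$, if $E[\alpha^i]=E[\gamma^i]$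 for all $i\ge1$. The $i$-th moment of $\alpha$ is $a_i=E[\alpha^i]$. The alphabet is assumed to contain infinitely many pairwise uncorrelated umbrae similar to any given umbra. The singleton umbra $\chi$ has $E[\chi]=1$ and $E[\chi^i]=0$ for $i\ge2$. Let $\chi_1,\ldots,\chi_n$ be pairwise uncorrelated umbrae similar to $\chi$ and also uncorrelated with $\alpha_1,\ldots,\alpha_n$. For every $i\ge1$, $n.(\chi\alpha^i)$ denotes $\chi_1\alpha_1^i+\cdots+\chi_n\alpha_n^i$, with the same $\chi_j$ and $\alpha_j$ used for all $i$ (so these polynomials are correlated with one another for different $i$). For an umbral polynomial $p$ and an integer $r\ge 0$, $p^{.r}$ denotes a product $p'p''\cdots p'''$ of $r$ pairwise uncorrelated copies of $p$ (each copy obtained by replacing the umbrae in $p$ with similar ones); $p^{.0}=1$. Thus $E[(\alpha_j^i)^{.r}]=a_i^{r}$, and the left-hand side of the claim, being a product of mutually uncorrelated factors, evaluates to the moment product $a_1^{r_1}a_2^{r_2}\cdots$. $(n)_k=n(n-1)\cdots(n-k+1)$ is the falling factorial. *)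

(* Defs.v *)
From HB Require Import structures.
From mathcomp Require Import all_boot all_order all_algebra.
From mathcomp Require Import finmap.
From mathcomp Require Import monalg.

Set Implicit Arguments.
Unset Strict Implicit.
Unset Printing Implicit Defensive.

Import GRing.Theory.

Local Open Scope ring_scope.

(* The polynomial ring R[A] in a possibly infinite set of commuting
   indeterminates: the monoid algebra of the free commutative monoid on A. *)
Notation umbral_poly A R := {malg R[{cmonom A}]}.

(* Locked: otherwise comparing [umbra R a] with [umbra R c] by conversion, as
   rewriting does, unfolds the monoid algebra and may not come back. *)
HB.lock Definition umbra (R : nzRingType) (A : choiceType) (a : A) :
    umbral_poly A R :=
  << ucm a >>.

Definition support (R : nzRingType) (A : choiceType) (p : umbral_poly A R) :
    {fset A} :=
  (\bigcup_(m <- msupp p) finsupp m)%fset.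

Definition uncorrelated (R : nzRingType) (A : choiceType)
    (p q : umbral_poly A R) : bool :=
  [disjoint support p & support q]%fset.

Definition pairwise_uncorrelated (R : nzRingType) (A : choiceType)
    (I : eqType) (p : I -> umbral_poly A R) : Prop :=
  forall i j : I, i != j -> uncorrelated (p i) (p j).

Section Umbral.

Variables (R : idomainType) (A : choiceType).
Notation P := (umbral_poly A R).
Notation K := {fraction R}.
Notation PK := (umbral_poly A K).
Notation "''u_' a" := (umbra R a) (at level 8, a at level 2, format "''u_' a").

Variable E : {scalar P}.

Definition similar_umbrae (a c : A) : Prop :=
  forall i : nat, (1 <= i)%N -> E ('u_a ^+ i) = E ('u_c ^+ i).

Record umbral_evaluation : Prop := UmbralEvaluation {
  eval_one : E 1 = 1;
  eval_uncorrelated : forall (s : seq A) (e : A -> nat), uniq s ->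
    E (\prod_(a <- s) 'u_a ^+ e a) = \prod_(a <- s) E ('u_a ^+ e a);
  eval_saturated : forall a : A, exists c : nat -> A,
    pairwise_uncorrelated (fun t => 'u_(c t))
    /\ (forall t, similar_umbrae (c t) a)
}.

Definition to_frac (p : P) : PK :=
  mmap (fun c : R => malgC (FracField.tofrac c)) (fun m => << m >>) p.

(* The K-linear extension of E to K[A]: see evalK_is_scalar, evalK_to_frac. *)
Definition evalK (p : PK) : K :=
  \sum_(m <- msupp p) p@_m * FracField.tofrac (E << m >>).

Definition umbral_equiv (p q : PK) : Prop := evalK p = evalK q.

Definition singleton_umbra (x : A) : Prop :=
  E 'u_x = 1 /\ (forall i : nat, (2 <= i)%N -> E ('u_x ^+ i) = 0).

Definition subst_umbrae (f : A -> A) (p : P) : P :=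
  mmap (fun c : R => malgC c)
       (fun m : {cmonom A} => \prod_(a <- finsupp m) 'u_(f a) ^+ m a) p.

(* Each umbra occurring in p is replaced by a similar one, distinct umbrae
   being replaced by distinct ones. *)
Definition is_copy (p q : P) : Prop :=
  exists f : A -> A,
    [/\ {in support p &, injective f},
        {in support p, forall a, similar_umbrae (f a) a}
      & q = subst_umbrae f p].

(* p^{.r} is only determined up to the choice of the copies of p, so it is
   rendered as the relation "q is a product of r uncorrelated copies of p". *)
Definition is_dot_power (p : P) (r : nat) (q : P) : Prop :=
  exists c : 'I_r -> P,
    [/\ forall t, is_copy p (c t),
        pairwise_uncorrelated c
      & q = \prod_(t < r) c t].

(* n.(chi alpha^i) = chi_1 alpha_1^i + ... + chi_n alpha_n^i *)
Definition dot_chi (n : nat) (chi alpha : 'I_n -> A) (i : nat) : P :=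
  \sum_(j < n) 'u_(chi j) * 'u_(alpha j) ^+ i.

End Umbral.

Definition is_partition (m : nat) (lam : seq nat) : bool :=
  [&& sorted geq lam, all (fun p => 0 < p)%N lam & sumn lam == m].

Definition part_mult (lam : seq nat) (i : nat) : nat := count_mem i lam.

Section Sanity.

Variables (R : idomainType) (A : choiceType) (E : {scalar (umbral_poly A R)}).

Lemma support_umbra (a : A) : support (umbra R a) = [fset a]%fset.
Proof. by rewrite /support umbra.unlock msuppU1 big_seq_fset1 mdomU. Qed.

Lemma uncorrelated_umbra (a c : A) :
  uncorrelated (umbra R a) (umbra R c) = (a != c).
Proof. by rewrite /uncorrelated !support_umbra fdisjoint1X in_fset1. Qed.

Lemma mcoeff_to_frac (p : umbral_poly A R) (m : {cmonom A}) :
  (to_frac p)@_m = FracField.tofrac p@_m.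
Proof.
rewrite /to_frac mmapE raddf_sum /= [p in RHS]monalgE !raddf_sum /=.
apply: eq_bigr => x _; rewrite mcoeffCM mcoeffU1 mcoeffU.
by case: (x == m); rewrite ?mulr1 ?mulr0 ?tofrac0.
Qed.

Lemma evalKE (d : {fset {cmonom A}}) (p : umbral_poly A {fraction R}) :
  (msupp p `<=` d)%fset ->
  evalK E p = \sum_(m <- d) p@_m * FracField.tofrac (E << m >>).
Proof.
move=> le; rewrite /evalK [LHS](big_fset_incl _ le) => //= x xd.
by move/mcoeff_outdom ->; rewrite mul0r.
Qed.

Lemma evalK_is_scalar c (p q : umbral_poly A {fraction R}) :
  evalK E (c *: p + q) = c * evalK E p + evalK E q.
Proof.
have ex_d : exists d, [/\ msupp (c *: p + q) `<=` d, msupp p `<=` d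
                        & msupp q `<=` d]%fset.
  exists (msupp (c *: p + q) `|` (msupp p `|` msupp q))%fset.
  by split; apply/fsubsetP => m; rewrite !in_fsetU => ->; rewrite ?orbT.
have [d [le_pq le_p le_q]] := ex_d.
rewrite (evalKE le_pq) (evalKE le_p) (evalKE le_q).
rewrite mulr_sumr -big_split /=; apply: eq_bigr => m _.
by rewrite mcoeffD mcoeffZ mulrDl mulrA.
Qed.

Lemma evalK_to_frac (p : umbral_poly A R) :
  evalK E (to_frac p) = FracField.tofrac (E p).
Proof.
have le : (msupp (to_frac p) `<=` msupp p)%fset.
  apply/fsubsetP => m; rewrite -!mcoeff_neq0 mcoeff_to_frac.
  by apply: contra => /eqP ->; rewrite tofrac0.
have monZ c (m : {cmonom A}) : << c *g m >> = c *: << m >> :> umbral_poly A R.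
  apply/malgP => x; rewrite [RHS]mcoeffZ [LHS]mcoeffU mcoeffU1.
  by case: (m == x); rewrite ?mulr1 ?mulr0.
rewrite (evalKE le) [p in RHS]monalgE !raddf_sum /=; apply: eq_bigr => m _.
by rewrite mcoeff_to_frac [in RHS]monZ linearZ tofracM.
Qed.

End Sanity.

(* Main.v *)
Require Import Defs.
From mathcomp Require Import all_boot all_order all_algebra.
From mathcomp Require Import finmap monalg.

Set Implicit Arguments.
Unset Strict Implicit.
Unset Printing Implicit Defensive.

Import GRing.Theory.

Local Open Scope ring_scope.

(** Both sides of the equivalence evaluate to the moment product
    a_1^{r_1} a_2^{r_2}...  On the left this is because a copy of alpha^i is
    the i-th power of a single umbra similar to alpha: the uncorrelated factors
    of the left-hand side are powers of pairwise distinct umbrae, so the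
    evaluation splits over them ([eval_dot_powers]).

    On the right, the product of the sums n.(chi alpha^i) runs over the k parts
    of lambda, with repetition; expanding it gives one term for each map f that
    assigns to every part p an index f p in {1, ..., n}, namely the product of
    the chi_{f p} alpha_{f p}^p.  The second and higher moments of chi vanish,
    so a term in which some index is used twice evaluates to 0.  If f is
    injective, the chi_{f p} contribute 1, the alpha_{f p} are distinct, and the
    term evaluates to the same moment product whatever f is ([eval_slots]).
    There are (n)_k injective maps, hence the right-hand side without its
    denominator evaluates to (n)_k times the left-hand side
    ([eval_prod_dot_chi]).  Since k <= m <= n and K has characteristic 0, (n)_k
    is invertible in K ([umbral_equiv_natr_inv]).

    Where a proof handles powers of two different umbrae at once, the equations
    are passed as explicit terms, so that conversion is never asked to tell such
    powers apart by unfolding the monoid algebra. *)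

(** * Parts of a partition and fibers of a map *)

(** Used with [r] the interval [1, m] and [s] a partition of [m], this passes
    from the multiplicities r_i to the list of parts. *)
Lemma big_by_value (I : eqType) (V : Type) (idx : V) (op : Monoid.com_law idx)
    (r s : seq I) (F : I -> V) :
  uniq r -> {subset s <= r} ->
  \big[op/idx]_(i <- r) \big[op/idx]_(p <- s | p == i) F i
    = \big[op/idx]_(p <- s) F p.
Proof.
move=> r_uniq s_r; rewrite (exchange_big_dep xpredT) //=.
rewrite !big_seq; apply: eq_bigr => p /s_r p_r.
under eq_bigl do rewrite eq_sym.
by rewrite -big_filter filter_pred1_uniq // big_seq1.
Qed.

Lemma parts_range m lam : is_partition m lam ->
  {subset lam <= index_iota 1 m.+1}.
Proof.
case/and3P=> _ /allP lam_pos /eqP <- p p_lam.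
rewrite mem_index_iota lam_pos //= ltnS sumnE.
by rewrite (big_rem p) //= leq_addr.
Qed.

Lemma size_partition m lam : is_partition m lam -> (size lam <= m)%N.
Proof.
case/and3P=> _ /allP lam_pos /eqP <-.
rewrite sumnE -sum1_size !big_seq; exact: leq_sum.
Qed.

Lemma sum_part_mult m lam : is_partition m lam ->
  (\sum_(1 <= i < m.+1) part_mult lam i)%N = size lam.
Proof.
move=> /parts_range lam_m; rewrite -sum1_size.
rewrite -(big_by_value _ _ (iota_uniq _ _) lam_m).
by apply: eq_bigr => i _; rewrite sum1_count.
Qed.

Lemma prod_part_mult (S : comNzRingType) (F : nat -> S) m lam :
  is_partition m lam ->
  \prod_(1 <= i < m.+1) F i ^+ part_mult lam i = \prod_(p <- lam) F p.
Proof.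
move=> /parts_range lam_m; rewrite -(big_by_value _ _ (iota_uniq _ _) lam_m).
by apply: eq_bigr => i _; rewrite big_const_seq iter_mulr_1.
Qed.

(** A fiber of an injection has at most one element, so [h] has to preserve
    only the neutral element, not the operation.  This is what makes moments,
    which are not multiplicative in the exponent, split over the fibers. *)
Lemma big_fiber_inj (I J : finType) (f : I -> J) j
    (V W : Type) (v : V) (w : W) (opV : Monoid.law v)
    (opW : Monoid.law w) (h : V -> W) (F : I -> V) :
  injective f -> h v = w ->
  h (\big[opV/v]_(t | f t == j) F t) = \big[opW/w]_(t | f t == j) h (F t).
Proof.
move=> f_inj hv; case: (pickP [pred t | f t == j]) => [t0 /= /eqP <- | no_t].
  by rewrite !(big_pred1 t0) // => t; apply: inj_eq.
by rewrite !big_pred0.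
Qed.

(** * Powers of umbrae as monomials *)

Lemma monomialM (R : nzRingType) (K : monomType) (m1 m2 : K) :
  << m1 >> * << m2 >> = << mmul m1 m2 >> :> {malg R[K]}.
Proof. by rewrite malgM_def fgmulUU mulr1. Qed.

Section Monomials.

Variables (R : idomainType) (A : choiceType).

Lemma umbraM_monomial a (M : {cmonom A}) :
  umbra R a * << M >> = << mulcm (ucm a) M >>.
Proof. by rewrite umbra.unlock; apply: monomialM. Qed.

Lemma prod_umbraX_monomial (I : Type) (s : seq I) (a : I -> A) (e : I -> nat) :
  exists2 M : {cmonom A},
    \prod_(t <- s) umbra R (a t) ^+ e t = << M >>
    & forall x, M x = (\sum_(t <- s) e t * (a t == x))%N.
Proof.
have umbraX_mul b i (M : {cmonom A}) : exists2 M' : {cmonom A},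
    umbra R b ^+ i * << M >> = << M' >>
    & forall x, M' x = (i * (b == x) + M x)%N.
  elim: i => [|i [M' defM' M'x]]; first by exists M; rewrite ?mul1r.
  exists (mulcm (ucm b) M') => [|x]; last first.
    by rewrite mulcmE ucmE M'x mulSn addnA.
  rewrite exprS -mulrA defM'; exact: umbraM_monomial.
elim: s => [|t s [M defM Mx]].
  by exists (@onecm A) => [|x]; rewrite big_nil ?onecmE.
rewrite big_cons defM; have [M' -> M'x] := umbraX_mul (a t) (e t) M.
exists M'; first exact: erefl.
by move=> x; rewrite M'x Mx big_cons.
Qed.

Lemma support_prod_umbraX (I : finType) (a : I -> A) (e : I -> nat) x :
  (x \in Defs.support (\prod_t umbra R (a t) ^+ e t))
    = [exists t, (0 < e t)%N && (a t == x)].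
Proof.
have [M -> Mx] := prod_umbraX_monomial (index_enum I) a e.
rewrite /Defs.support msuppU1 big_seq_fset1 -cmE_neq0 Mx sum_nat_eq0.
rewrite negb_forall.
by apply: eq_existsb => t; rewrite muln_eq0 negb_or eqb0 negbK lt0n.
Qed.

Lemma umbraX_monomial (a : A) i : exists2 M : {cmonom A},
  umbra R a ^+ i = << M >> & forall x, M x = (i * (a == x))%N.
Proof.
have [M defM Mx] := prod_umbraX_monomial [:: tt] (fun=> a) (fun=> i).
by exists M => [|x]; rewrite -?defM ?Mx big_seq1.
Qed.

Lemma finsupp_power (M : {cmonom A}) (a : A) i : (0 < i)%N ->
  (forall x, M x = i * (a == x))%N -> finsupp M = [fset a]%fset.
Proof.
move=> i_gt0 Mx; apply/fsetP => x.
by rewrite -cmE_neq0 Mx muln_eq0 negb_or -lt0n i_gt0 eqb0 negbK in_fset1 eq_sym.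
Qed.

Lemma support_umbraX (a : A) i : (0 < i)%N ->
  Defs.support (umbra R a ^+ i) = [fset a]%fset.
Proof.
move=> i_gt0; have [M -> Mx] := umbraX_monomial a i.
by rewrite /Defs.support msuppU1 big_seq_fset1 (finsupp_power i_gt0 Mx).
Qed.

(** For variables [p] and [q], so that rewriting the supports of two powers of
    different umbrae does not compare these powers. *)
Lemma uncorrelated_singletons (p q : umbral_poly A R) (a c : A) :
  Defs.support p = [fset a]%fset -> Defs.support q = [fset c]%fset ->
  uncorrelated p q = (a != c).
Proof. by rewrite /uncorrelated => -> ->; rewrite fdisjoint1X in_fset1. Qed.

Lemma subst_umbraX (f : A -> A) a i : (0 < i)%N ->
  subst_umbrae f (umbra R a ^+ i) = umbra R (f a) ^+ i.
Proof.
move=> i_gt0; have [M -> Mx] := umbraX_monomial a i.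
rewrite /subst_umbrae mmapU (finsupp_power i_gt0 Mx) big_seq_fset1 Mx eqxx.
by rewrite muln1 /= mpolyC1E mul1r.
Qed.

End Monomials.

(** * Evaluation of uncorrelated products *)

Section Evaluation.

Variables (R : idomainType) (A : choiceType).
Variable E : {scalar (umbral_poly A R)}.
Hypothesis evalE : umbral_evaluation E.
Notation "''u_' a" := (umbra R a) (at level 8, a at level 2, format "''u_' a").

(** The multiplicativity axiom of [E] takes exponents indexed by the umbrae;
    an injective family of umbrae lets them be indexed by any finite type. *)
Lemma eval_prod_inj (I : finType) (a : I -> A) (e : I -> nat) : injective a ->
  E (\prod_t 'u_(a t) ^+ e t) = \prod_t E ('u_(a t) ^+ e t).
Proof.
move=> a_inj.
(* The exponent of an umbra x is e t for the only t with a t = x. *)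
have e'E t : odflt 0%N (omap e [pick t' | a t' == a t]) = e t.
  case: pickP => [t' /eqP/a_inj -> // | /(_ t)]; by rewrite eqxx.
pose e' x := odflt 0%N (omap e [pick t' | a t' == x]).
have: E (\prod_(x <- map a (index_enum I)) 'u_x ^+ e' x)
        = \prod_(x <- map a (index_enum I)) E ('u_x ^+ e' x).
  by apply: eval_uncorrelated => //; rewrite map_inj_uniq ?index_enum_uniq.
rewrite !big_map; under eq_bigr do rewrite /e' e'E.
by move=> ->; apply: eq_bigr => t _; rewrite /e' e'E.
Qed.

Lemma eval_similarX a c i : similar_umbrae E a c ->
  E ('u_a ^+ i) = E ('u_c ^+ i).
Proof. by case: i => [|i] sim_ac; [rewrite !expr0 | apply: sim_ac]. Qed.

Lemma pairwise_uncorrelated_inj (I : finType) (a : I -> A) :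
  pairwise_uncorrelated (fun t => 'u_(a t)) -> injective a.
Proof.
move=> a_unc t t' eq_a; apply: contraTeq isT => /a_unc.
by rewrite uncorrelated_umbra eq_a eqxx.
Qed.

(** For i > 0 the support of [a^i] is [{a}], so the relabelling behind each
    copy amounts to choosing one umbra similar to [a], and uncorrelated copies
    choose distinct ones. *)
Lemma dot_power_umbraX a i r q : (0 < i)%N ->
  is_dot_power E ('u_a ^+ i) r q ->
  exists b : 'I_r -> A, [/\ injective b, forall t, similar_umbrae E (b t) a
    & q = \prod_t 'u_(b t) ^+ i].
Proof.
move=> i_gt0 [c [c_copy c_unc ->]].
have copyE t : exists b, similar_umbrae E b a /\ c t = 'u_b ^+ i.
  have [f [_ f_sim ->]] := c_copy t.
  exists (f a); rewrite (subst_umbraX _ _ _ i_gt0); split; last exact: erefl.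
  by apply: f_sim; rewrite (support_umbraX _ _ i_gt0) in_fset1.
have [b bP] := fin_all_exists copyE.
exists b; split=> [t t' eq_b | t |]; last 2 first.
- by case: (bP t).
- by apply: eq_bigr => t _; case: (bP t).
apply: contraTeq isT => /c_unc.
have [_ ->] := bP t; have [_ ->] := bP t'.
have supp x := support_umbraX R (b x) i_gt0.
by rewrite (uncorrelated_singletons (supp t) (supp t')) eq_b eqxx.
Qed.

(** Within one [L i] the chosen umbrae are distinct because the copies are
    uncorrelated, and across different [L i] because these are; hence the family
    indexed by all pairs (exponent, copy) is injective. *)
Lemma eval_dot_powers (alpha : A) m (a : nat -> A) (r : nat -> nat)
    (L : nat -> umbral_poly A R) :
  (forall i, similar_umbrae E (a i) alpha) ->
  (forall i, (1 <= i <= m)%N -> is_dot_power E ('u_(a i) ^+ i) (r i) (L i)) ->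
  (forall i1 i2, (1 <= i1 <= m)%N -> (1 <= i2 <= m)%N -> i1 != i2 ->
     uncorrelated (L i1) (L i2)) ->
  E (\prod_(1 <= i < m.+1) L i)
    = \prod_(1 <= i < m.+1) E ('u_alpha ^+ i) ^+ r i.
Proof.
move=> a_sim L_dot L_unc; rewrite !big_add1 /= !big_mkord.
(* The range 1..m has become 'I_m, hence the exponents i.+1. *)
have L_copies (i : 'I_m) : exists b : 'I_(r i.+1) -> A,
    [/\ injective b, forall t, similar_umbrae E (b t) (a i.+1)
      & L i.+1 = \prod_t 'u_(b t) ^+ i.+1].
  exact: dot_power_umbraX (ltn0Sn i) (L_dot i.+1 (ltn_ord i)).
have [b bP] := fin_all_exists L_copies.
have b_supp i t : b i t \in Defs.support (L i.+1).
  have [_ _ ->] := bP i; rewrite support_prod_umbraX.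
  by apply/existsP; exists t; rewrite eqxx.
pose b' (x : {i : 'I_m & 'I_(r i.+1)}) := b (tag x) (tagged x).
have b'_inj : injective b'.
  move=> [i t] [i' t']; rewrite /b' /= => eq_b.
  have eq_i : i = i'.
    apply: contraTeq isT => ne_i.
    have /fdisjointP/(_ _ (b_supp i t)) : uncorrelated (L i.+1) (L i'.+1).
      by apply: L_unc; rewrite ?ltn_ord ?eqSS.
    by rewrite eq_b b_supp.
  case: _ / eq_i t' eq_b => t'; have [b_inj _ _] := bP i.
  by move/b_inj ->.
under eq_bigr => i _ do have [_ _ ->] := bP i.
rewrite (sig_big_dep _ _ (fun i t => 'u_(b i t) ^+ i.+1)) /=.
rewrite (eval_prod_inj (fun x : {i : 'I_m & 'I_(r i.+1)} => (tag x).+1) b'_inj).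
rewrite -(sig_big_dep xpredT (fun=> xpredT)
  (fun i t => E ('u_(b i t) ^+ i.+1))) /=.
apply: eq_bigr => i _; rewrite -[in RHS](card_ord (r i.+1)) -prodr_const.
apply: eq_bigr => t _; have [_ b_sim _] := bP i.
exact: etrans (eval_similarX _ (b_sim t)) (eval_similarX _ (a_sim _)).
Qed.

(** * Products of the sums n.(chi alpha^i) *)

Section SingletonSums.

Variables (alpha chi : A) (n : nat) (al ch : 'I_n -> A).
Hypothesis al_unc : pairwise_uncorrelated (fun j => 'u_(al j)).
Hypothesis al_sim : forall j, similar_umbrae E (al j) alpha.
Hypothesis chi_singleton : singleton_umbra E chi.
Hypothesis ch_unc : pairwise_uncorrelated (fun j => 'u_(ch j)).
Hypothesis ch_sim : forall j, similar_umbrae E (ch j) chi.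
Hypothesis ch_al_unc : forall i j, uncorrelated 'u_(ch i) 'u_(al j).

Lemma eval_ch_al (c d : 'I_n -> nat) :
  E (\prod_j ('u_(ch j) ^+ c j * 'u_(al j) ^+ d j))
    = \prod_j (E ('u_chi ^+ c j) * E ('u_alpha ^+ d j)).
Proof.
(* All the ch j and al j together are one injective family on 'I_n + 'I_n. *)
pose g (x : 'I_n + 'I_n) := match x with inl j => ch j | inr j => al j end.
pose e (x : 'I_n + 'I_n) := match x with inl j => c j | inr j => d j end.
have ch_inj := pairwise_uncorrelated_inj ch_unc.
have al_inj := pairwise_uncorrelated_inj al_unc.
have ch_neq_al i j : ch i <> al j.
  by apply/eqP; rewrite -(uncorrelated_umbra R).
have g_inj : injective g.
  move=> [i|i] [j|j] /=; [by move/ch_inj-> | | | by move/al_inj->].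
    by move/ch_neq_al.
  by move/esym/ch_neq_al.
(* Stated for an abstract F, to serve both before and after evaluation. *)
have prod_g (S : comNzRingType) (F : A -> nat -> S) :
    \prod_x F (g x) (e x) = \prod_j (F (ch j) (c j) * F (al j) (d j)).
  by rewrite big_sumType /= big_split.
rewrite -(prod_g _ (fun a i => 'u_a ^+ i)) (eval_prod_inj e g_inj).
rewrite (prod_g _ (fun a i => E ('u_a ^+ i))).
apply: eq_bigr => j _.
exact: (f_equal2 *%R (eval_similarX (c j) (ch_sim j))
                     (eval_similarX (d j) (al_sim j))).
Qed.

Lemma eval_singletonX c : E ('u_chi ^+ c) = (c <= 1)%:R.
Proof.
have [chi1 chi_ge2] := chi_singleton.
case: c => [|[|c]]; [by rewrite expr0 eval_one | by rewrite expr1 |].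
exact: chi_ge2.
Qed.

(** The term of the expansion given by f.  Grouping the slots t by the value
    j = f t, the umbra chi_j gets the size of the fiber as exponent, and its
    moment vanishes as soon as two slots collide; otherwise each alpha_j carries
    the exponent of at most one slot. *)
Lemma eval_slots (I : finType) (f : I -> 'I_n) (w : I -> nat) :
  E (\prod_t ('u_(ch (f t)) * 'u_(al (f t)) ^+ w t))
    = (injectiveb f)%:R * \prod_t E ('u_alpha ^+ w t).
Proof.
rewrite (partition_big f xpredT) //=.
have -> : \prod_j \prod_(t | f t == j) ('u_(ch (f t)) * 'u_(al (f t)) ^+ w t)
  = \prod_j ('u_(ch j) ^+ #|[pred t | f t == j]|
             * 'u_(al j) ^+ (\sum_(t | f t == j) w t)%N).
  apply: eq_bigr => j _; rewrite -prodr_const -prodrXr -big_split /=.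
  by apply: eq_bigr => t /eqP ->.
rewrite eval_ch_al; case: injectiveP => [f_inj | /injectiveP/injectivePn].
  rewrite mul1r [RHS](partition_big f xpredT) //=; apply: eq_bigr => j _.
  rewrite eval_singletonX (_ : (_ <= 1)%N) ?mul1r.
    apply: (big_fiber_inj _ _ _ (h := fun d => E ('u_alpha ^+ d))) => //.
    by rewrite expr0 eval_one.
  apply/card_le1_eqP => t t'; rewrite !inE => /eqP <- /eqP; exact: f_inj.
move=> [t [t' ne_t eq_f]]; rewrite mul0r (bigD1 (f t)) //= eval_singletonX.
rewrite leqNgt (_ : (1 < _)%N) ?mul0r //.
by apply/card_gt1P; exists t, t'; rewrite !inE eq_f eqxx.
Qed.

Lemma eval_prod_dot_chi (w : seq nat) :
  E (\prod_(p <- w) dot_chi R ch al p)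
    = (n ^_ size w)%:R * \prod_(p <- w) E ('u_alpha ^+ p).
Proof.
rewrite !(big_tnth _ _ w) bigA_distr_bigA /= raddf_sum /=.
under eq_bigr do rewrite eval_slots.
rewrite -mulr_suml -natr_sum; congr (_%:R * _).
rewrite -big_mkcond /= sum1_card.
have := card_inj_ffuns 'I_(size w) 'I_n; rewrite !card_ord => <-.
by apply: eq_card => f; rewrite !inE.
Qed.

End SingletonSums.

End Evaluation.

(** * Division by the falling factorial *)

Lemma evalKZ (R : idomainType) (A : choiceType) (E : {scalar (umbral_poly A R)})
    (c : {fraction R}) (p : umbral_poly A {fraction R}) :
  evalK E (c *: p) = c * evalK E p.
Proof.
have evalK0 : evalK E (0 : umbral_poly A {fraction R}) = 0.
  by rewrite /evalK msupp0 big_seq_fset0.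
by have := evalK_is_scalar E c p 0; rewrite addr0 evalK0 addr0.
Qed.

Lemma umbral_equiv_natr_inv (R : idomainType) (A : choiceType)
    (E : {scalar (umbral_poly A R)}) (N : nat) (p q : umbral_poly A R) :
  [pchar {fraction R}] =i pred0 -> N != 0%N -> E q = N%:R * E p ->
  umbral_equiv E (to_frac p) (N%:R^-1 *: to_frac q).
Proof.
move=> charK0 N_neq0 Eq.
rewrite /umbral_equiv [RHS]evalKZ [in LHS]evalK_to_frac [in RHS]evalK_to_frac.
rewrite Eq tofracM rmorph_nat mulKf //.
by have /pcharf0P -> := charK0.
Qed.

Theorem theorem4p1 (R : idomainType) (A : choiceType)
    (E : {scalar (umbral_poly A R)})
    (charK0 : [pchar {fraction R}] =i pred0)
    (evalE : umbral_evaluation E)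
    (n : nat) (n_gt0 : (0 < n)%N)
    (alpha : A) (al : 'I_n -> A)
    (al_unc : pairwise_uncorrelated (fun j => umbra R (al j)))
    (al_sim : forall j, similar_umbrae E (al j) alpha)
    (chi : A) (chi_singleton : singleton_umbra E chi)
    (ch : 'I_n -> A)
    (ch_unc : pairwise_uncorrelated (fun j => umbra R (ch j)))
    (ch_sim : forall j, similar_umbrae E (ch j) chi)
    (ch_al_unc : forall i j, uncorrelated (umbra R (ch i)) (umbra R (al j)))
    (m : nat) (m_le_n : (m <= n)%N)
    (lam : seq nat) (lam_part : is_partition m lam)
    (j : nat -> 'I_n)
    (L : nat -> umbral_poly A R)
    (L_dot : forall i, (1 <= i <= m)%N ->
       is_dot_power E (umbra R (al (j i)) ^+ i) (part_mult lam i) (L i))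
    (L_unc : forall i1 i2, (1 <= i1 <= m)%N -> (1 <= i2 <= m)%N -> i1 != i2 ->
       uncorrelated (L i1) (L i2)) :
  let k := (\sum_(1 <= i < m.+1) part_mult lam i)%N in
  umbral_equiv E
    (to_frac (\prod_(1 <= i < m.+1) L i))
    ((n ^_ k)%:R^-1 *:
       to_frac (\prod_(1 <= i < m.+1) dot_chi R ch al i ^+ part_mult lam i)).
Proof.
rewrite /= (sum_part_mult lam_part).
have k_le_n : (size lam <= n)%N.
  exact: leq_trans (size_partition lam_part) m_le_n.
apply: (umbral_equiv_natr_inv charK0); first by rewrite -lt0n ffact_gt0.
rewrite (prod_part_mult _ lam_part).
rewrite (eval_prod_dot_chi evalE al_unc al_sim chi_singleton ch_unc ch_sim
  ch_al_unc).
rewrite (eval_dot_powers evalE (fun i => al_sim (j i)) L_dot L_unc).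
by rewrite (prod_part_mult _ lam_part).
Qed.
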